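(* Let $p$ be a prime, $k\ge 1$ an integer, $q=p^k$, let $f(x)\in\mathbb F_q[x]$ and $a\in\mathbb F_q$. Then: (i) The polynomial $m_f(x)$ has integer coefficients. The sequence $\{u_s(f,a)\}_{s=1}^\infty$ is a linear recursion sequence and $m_f(x)$ is a generating polynomial of it. Moreover, $m_f(x)$ is the minimal polynomial of the sequence $\{u_s(f,0)\}_{s=1}^\infty$. (ii) As formal power series (equivalently, as rational functions) in $x$, $$\sum_{s=1}^{\infty}N_{s}(f,a)x^s=\frac{x}{1-qx}-\frac{x\,\tilde M_{f,a}(x)}{q\,M_f(x)},$$ where $$M_f(x):=\prod_{\substack{m\in\mathbb F_q^{*}\\ S_{f,m}\neq 0}}\Big(x-\frac{1}{S_{f,m}}\Big),\qquad \tilde M_{f,a}(x):=\sum_{\substack{n\in \mathbb F_q^{*}\\ S_{f,n}\neq0}}\zeta_p^{\mathrm{Tr}(-na)}\prod_{\substack{m\in \mathbb F_q^{*}\setminus\{n\}\\ S_{f,m}\neq 0}}\Big(x-\frac{1}{S_{f,m}}\Big)$$ (the products run over elements $m$, so repeated values of $S_{f,m}$ give repeated factors). In particular, for $a=0$, $\tilde M_{f,0}(x)=M_f'(x)$, the derivative of $M_f(x)$, so that $\sum_{s\ge1}N_s(f,0)x^s=\frac{x}{1-qx}-\frac{xM_f'(x)}{qM_f(x)}$.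
   Context: $\mathbb F_q$ is the finite field with $q=p^k$ elements, $\mathbb F_q^*=\mathbb F_q\setminus\{0\}$. $\mathrm{Tr}(b)=\sum_{i=0}^{k-1}b^{p^i}$ is the trace map $\mathbb F_q\to\mathbb F_p$, and $\zeta_p=\exp(2\pi i/p)$ (exponents in $\mathbb F_p$ are read as integers mod $p$). For $m\in\mathbb F_q$, $S_{f,m}:=\sum_{x\in\mathbb F_q}\zeta_p^{\mathrm{Tr}(mf(x))}$. Let $\Omega_f:=\{S_{f,m}: m\in\mathbb F_q^*,\ S_{f,m}\neq0\}$ (the set of distinct nonzero values) and $m_f(x):=\prod_{\lambda\in\Omega_f}(x-\lambda)$. For $s\ge1$, $N_s(f,a)$ is the number of $(x_1,\dots,x_s)\in\mathbb F_q^s$ with $f(x_1)+\cdots+f(x_s)=a$, and $u_s(f,a):=N_s(f,a)-q^{s-1}$. A sequence of integers $\{a_s\}_{s\ge1}$ is a linear recursion sequence if there is $g(x)=\sum_{i=0}^d k_ix^i\in\mathbb Z[x]$ with $k_d\neq0$ such that $k_0a_{j+1}+k_1a_{j+2}+\cdots+k_da_{j+d+1}=0$ for all integers $j\ge0$; such $g$ is called a generating polynomial of the sequence. The generating polynomials form a principal ideal of $\mathbb Z[x]$, generated by a polynomial $h$ of minimal degree whose coefficients have gcd $1$ (unique up to sign); $h$ is the minimal polynomial of the sequence, and its degree is the degree of the sequence. *)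

(* Defs.v *)
From HB Require Import structures.
From mathcomp Require Import all_boot all_order all_algebra all_field.
Set Implicit Arguments. Unset Strict Implicit. Unset Printing Implicit Defensive.
Import Order.TTheory GRing.Theory Num.Theory.
Local Open Scope ring_scope.

Section Defs.
Variables (p k : nat) (F : finFieldType).

(* zeta_p = exp(2 pi i / p) in algC: p.-root (-1) is the p-th root of -1 of
   minimal nonnegative argument, i.e. exp(i pi / p); its square is exp(2 pi i/p). *)
Definition zeta : algC := (p.-root (-1)) ^+ 2.

Definition Tr (b : F) : F := \sum_(i < k) b ^+ (p ^ i).

Definition Fp_to_nat (t : F) : nat :=
  odflt 0%N (omap (@nat_of_ord p) [pick i : 'I_p | (i : nat)%:R == t]).

Definition psi (b : F) : algC := zeta ^+ Fp_to_nat (Tr b).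

Definition S (f : {poly F}) (m : F) : algC := \sum_(x : F) psi (m * f.[x]).

Definition Omega (f : {poly F}) : seq algC :=
  undup [seq S f m | m <- enum F & (m != 0) && (S f m != 0)].

Definition mf (f : {poly F}) : {poly algC} :=
  \prod_(l <- Omega f) ('X - l%:P).

Definition Ns (f : {poly F}) (a : F) (s : nat) : nat :=
  #|[set x : {ffun 'I_s -> F} | \sum_(i < s) f.[x i] == a]|.

Definition us (f : {poly F}) (a : F) (s : nat) : int :=
  (Ns f a s)%:Z - ((p ^ k) ^ s.-1)%N%:Z.

Definition Mf (f : {poly F}) : {poly algC} :=
  \prod_(m : F | (m != 0) && (S f m != 0)) ('X - (S f m)^-1%:P).

Definition Mt (f : {poly F}) (a : F) : {poly algC} :=
  \sum_(n : F | (n != 0) && (S f n != 0))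
     psi (- n * a) *:
       \prod_(m : F | [&& m != 0, m != n & S f m != 0]) ('X - (S f m)^-1%:P).

End Defs.

(* Linear recursion sequences: a sequence {a_s}_{s>=1} is represented by
   a : nat -> int, with a s = a_s (the value at 0 is irrelevant). *)
Definition is_gen_poly (a : nat -> int) (g : {poly int}) : Prop :=
  g != 0 /\ forall j : nat, \sum_(i < size g) g`_i * a (j + i).+1 = 0.

Definition is_min_poly (a : nat -> int) (h : {poly int}) : Prop :=
  [/\ is_gen_poly a h,
      (forall g, is_gen_poly a g -> exists r : {poly int}, g = r * h),
      (forall g, is_gen_poly a g -> (size h <= size g)%N) &
      \big[gcdn/0%N]_(c <- h) absz c = 1%N].

Definition fps := nat -> algC.
Definition fps_of_poly (P : {poly algC}) : fps := fun n => P`_n.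
Definition fps_sub (A B : fps) : fps := fun n => A n - B n.
Definition fps_mul (A B : fps) : fps :=
  fun n => \sum_(i < n.+1) A i * B (n - i)%N.
(* coefficients b_0..b_n of the inverse of A (meaningful when A 0 != 0) *)
Fixpoint fps_inv_seq (A : fps) (n : nat) : seq algC :=
  match n with
  | 0 => [:: (A 0%N)^-1]
  | n'.+1 => let s := fps_inv_seq A n' in
             rcons s (- (A 0%N)^-1 * \sum_(i < n'.+1) A i.+1 * nth 0 s (n' - i)%N)
  end.
Definition fps_inv (A : fps) : fps := fun n => nth 0 (fps_inv_seq A n) n.

(* Main.v *)
(** Orthogonality of the additive characters [b |-> psi (m * b)] gives
    [q * N_s(f, a) = \sum_m psi (- m * a) * S_{f,m} ^ s], and [m = 0] accounts
    for the main term [q ^ s]; so [q * u_s(f, a)] is an exponential sum in the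
    nonzero [S_{f,m}], and summing the geometric series gives (ii).  For
    [a = 0] all weights are positive, and testing a recurrence against
    polynomials vanishing at all but one element of [Omega_f] forces its
    characteristic polynomial to vanish on [Omega_f].  The automorphisms of
    [Q(zeta_p)] permute [Omega_f], because [zeta_p |-> zeta_p ^ t] sends
    [S_{f,m}] to [S_{f,tm}]; hence [m_f] has integer coefficients. *)

Require Import Defs.
From HB Require Import structures.
From mathcomp Require Import all_boot all_order all_algebra all_field.
Set Implicit Arguments. Unset Strict Implicit. Unset Printing Implicit Defensive.
Import Order.TTheory GRing.Theory Num.Theory.
Local Open Scope ring_scope.

(** * Primitive roots of unity and the prime subfield *)

Lemma zeta_prim (p : nat) : prime p -> p.-primitive_root (zeta p).
Proof.
move=> p_pr; have p_gt0 := prime_gt0 p_pr.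
set r := p.-root (-1) : algC; have rp : r ^+ p = -1 by rewrite rootCK.
have zp : zeta p ^+ p = 1 by rewrite /zeta -exprM mulnC exprM rp sqrrN expr1n.
have [m m_prim m_dvd] := prim_order_exists p_gt0 zp.
case/primeP: (p_pr) => _ /(_ _ m_dvd) /orP[/eqP m1|/eqP mp]; last first.
  by rewrite mp in m_prim.
have z1 : zeta p = 1 by have := prim_expr_order m_prim; rewrite m1.
have /eqP: r ^+ 2 = 1 by [].
(* [r = 1] contradicts [r ^+ p = -1], and [r = -1] is excluded because a principal root of index
   above 1 is never negative. *)
rewrite sqrf_eq1 => /orP[] /eqP r1.
  by move/eqP: rp; rewrite r1 expr1n -subr_eq0 opprK -(natrD _ 1 1) pnatr_eq0.
have := rootC_lt0 (-1 : algC) (prime_gt1 p_pr).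
by rewrite -/r r1 ltrN10.
Qed.

Lemma natr_eq_mod (R : nzRingType) (p i j : nat) :
  p \in [pchar R] -> (i%:R == j%:R :> R) = (i == j %[mod p]).
Proof.
move=> cR; wlog le_ij : i j / (i <= j)%N => [th|].
  by case/orP: (leq_total i j) => /th // e; rewrite eq_sym e eq_sym.
by rewrite eq_sym -subr_eq0 -natrB // -(dvdn_pcharf cR) eq_sym eqn_mod_dvd.
Qed.

(** Elements fixed by Frobenius are roots of ['X^p - 'X]; one outside the images of [0..p-1] would
    be a root number [p + 1]. So the default 0 in [Fp_to_nat] is never reached on traces. *)
Lemma Fp_to_natK (p : nat) (F : finFieldType) (t : F) :
  p \in [pchar F] -> t ^+ p = t -> (Fp_to_nat p t)%:R = t.
Proof.
move=> cF tp; rewrite /Fp_to_nat; case: pickP => [i /eqP //|none].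
have p_pr := pcharf_prime cF.
pose rs := [seq (nat_of_ord i)%:R : F | i <- enum 'I_p].
have: (size (t :: rs) < size ('X^p - 'X : {poly F})%R)%N.
  apply: max_poly_roots.
  - rewrite -size_poly_eq0 size_polyDl size_polyXn // size_polyN size_polyX.
    by rewrite ltnS prime_gt1.
  - rewrite /= /root !hornerE tp subrr eqxx /=; apply/allP=> _ /mapP[i _ ->].
    by rewrite /root !hornerE -(pFrobenius_autE cF) pFrobenius_aut_nat subrr.
  - rewrite /= map_inj_uniq ?enum_uniq; last first.
      move=> i j /eqP; rewrite (natr_eq_mod _ _ cF) !modn_small // => /eqP.
      exact: val_inj.
    rewrite andbT; apply/negP=> /mapP[i _ ti].
    by have:= none i; rewrite ti eqxx.
rewrite /= size_map -cardE card_ord size_polyDl size_polyXn ?ltnn //.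
by rewrite size_polyN size_polyX ltnS prime_gt1.
Qed.

Lemma prim_root_power_sum (R : idomainType) (n i : nat) (z : R) :
  n.-primitive_root z -> \sum_(t < n) z ^+ (i * t) = (n %| i)%:R * n%:R.
Proof.
move=> z_prim; have zi := prim_order_dvd z_prim i.
under eq_bigr do rewrite exprM.
case: eqP zi => [zi1 ->|zi_neq1 ->].
  by under eq_bigr do rewrite zi1 expr1n; rewrite sumr_const card_ord mul1r.
apply/eqP; rewrite mul0r; apply: contraT => sum_neq0; case: zi_neq1.
apply/eqP; rewrite -subr_eq0; apply/eqP/(mulIf sum_neq0).
rewrite mul0r -subrX1 -exprM mulnC exprM (prim_expr_order z_prim) expr1n.
exact: subrr.
Qed.

(* Averaging over [Gal(Q(z)/Q)] sends each power of [z] into [Z/(p-1)], so a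
   Galois-invariant element of [Z[z]] is a rational algebraic integer. *)
Lemma Galois_invariant_int (p : nat) (z : algC) (P : {poly int}) :
  prime p -> p.-primitive_root z ->
  let c := (map_poly intr P).[z] in
  (forall u : {rmorphism algC -> algC}, u c = c) -> c \is a Num.int.
Proof.
move=> p_pr z_prim c c_fixed.
have cE : c = \sum_(i < size P) (P`_i)%:~R * z ^+ i.
  rewrite /c (horner_coef_wide z (size_poly _ _)).
  by apply: eq_bigr => i _; rewrite coef_map.
have zA := Aint_prim_root z_prim.
have conjE (t : nat) :
    coprime t p -> c = \sum_(i < size P) (P`_i)%:~R * z ^+ (i * t).
  move=> /Qn_aut_exists[u uE]; rewrite -(c_fixed u) cE rmorph_sum.
  apply: eq_bigr => i _; rewrite rmorphM rmorph_int rmorphXn /=.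
  by rewrite uE ?(prim_expr_order z_prim) // -exprM mulnC.
have p_gt0 := prime_gt0 p_pr.
(* Sum the expressions of [conjE] over all [t < p]: [t = 0] gives the sum of the coefficients, and
   each of the other [p.-1] exponents gives [c]. *)
have trace : \sum_(i < size P) (P`_i)%:~R * ((p %| i)%:R * p%:R)
    = \sum_(i < size P) (P`_i)%:~R + p.-1%:R * c.
  under eq_bigr do rewrite -(prim_root_power_sum _ z_prim) mulr_sumr.
  rewrite exchange_big /= -(prednK p_gt0) big_ord_recl /=; congr (_ + _).
    by apply: eq_bigr => i _; rewrite muln0 expr0 mulr1.
  rewrite (eq_bigr (fun=> c)) ?sumr_const ?card_ord ?mulr_natl // => t _.
  rewrite -conjE // coprime_sym prime_coprime //.
  by rewrite gtnNdvd //= /bump /= add1n -[X in (_ < X)%N](prednK p_gt0) ltnS.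
have p1_neq0 : p.-1%:R != 0 :> algC.
  by rewrite pnatr_eq0 -lt0n -ltnS prednK // prime_gt1.
apply: Cint_rat_Aint.
  have -> : c = (p.-1%:R * c) / p.-1%:R by rewrite mulrC mulKf.
  rewrite -[p.-1%:R * c](addKr (\sum_(i < size P) (P`_i)%:~R)) -trace.
  apply: rpred_div; rewrite ?rpred_nat // rpredD ?rpredN ?rpred_sum // => i _.
    exact: rpred_int.
  by rewrite !rpredM ?rpred_nat // rpred_int.
rewrite cE rpred_sum // => i _.
by rewrite rpredM ?rpredX ?rpred_int.
Qed.

(** * Product rule, power series quotients, divisibility over the integers *)

Lemma deriv_prod (R : comNzRingType) (I : eqType) (r : seq I) (P : pred I)
    (q : I -> {poly R}) :
  uniq r ->
  (\prod_(i <- r | P i) q i)^`()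
    = \sum_(i <- r | P i) (q i)^`() * \prod_(j <- r | P j && (j != i)) q j.
Proof.
elim: r => [|x r IHr] /=; first by rewrite !big_nil derivC.
case/andP=> x_r uniq_r; rewrite !big_cons.
(* As [r] has no second copy of [x], excluding [x] from the tail removes no factor. *)
have prod_r : \prod_(j <- r | P j && (j != x)) q j = \prod_(j <- r | P j) q j.
  rewrite big_seq_cond [RHS]big_seq_cond; apply: eq_bigl => j.
  by have [->|_] := eqVneq j x; rewrite ?(negPf x_r) // andbT.
have sum_r : \sum_(i <- r | P i)
      (q i)^`() * \prod_(j <- x :: r | P j && (j != i)) q j
    = (if P x then q x else 1) * (\prod_(i <- r | P i) q i)^`().
  rewrite IHr // mulr_sumr big_seq_cond [RHS]big_seq_cond; apply: eq_bigr => i.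
  case/andP=> i_r _; rewrite big_cons.
  have -> : x != i by apply: contraNneq x_r => ->.
  by case: (P x); rewrite ?mul1r //= mulrCA.
rewrite sum_r eqxx andbF prod_r; case: (P x); last by rewrite mul1r.
by rewrite derivM.
Qed.

Lemma size_fps_inv_seq (A : fps) (n : nat) : size (fps_inv_seq A n) = n.+1.
Proof. by elim: n => //= n IHn; rewrite size_rcons IHn. Qed.

Lemma fps_inv_seq_nth (A : fps) (n i : nat) :
  (i <= n)%N -> nth 0 (fps_inv_seq A n) i = fps_inv A i.
Proof.
elim: n => [|n IHn]; first by rewrite leqn0 => /eqP->.
rewrite leq_eqVlt => /orP[/eqP -> //|le_in].
by rewrite /= nth_rcons size_fps_inv_seq le_in IHn.
Qed.

Lemma fps_mulV (A : fps) (n : nat) :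
  A 0%N != 0 -> fps_mul A (fps_inv A) n = (n == 0%N)%:R.
Proof.
move=> A0; rewrite /fps_mul big_ord_recl subn0.
case: n => [|n]; first by rewrite big_ord0 addr0 divff.
have -> : fps_inv A n.+1
    = - (A 0%N)^-1 * \sum_(i < n.+1) A i.+1 * fps_inv A (n - i)%N.
  rewrite {1}/fps_inv /= nth_rcons size_fps_inv_seq ltnn eqxx; congr (_ * _).
  by apply: eq_bigr => i _; rewrite fps_inv_seq_nth // leq_subr.
rewrite mulNr mulrN mulVKf // addrC; apply/eqP; rewrite subr_eq0; apply/eqP.
by apply: eq_bigr => i _; rewrite lift0 subSS.
Qed.

(** Truncation moves coefficient computations into [{poly algC}], where the ring laws are
    available. *)
Lemma fps_mul_poly (P : {poly algC}) (B : fps) (N n : nat) :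
  (n < N)%N -> fps_mul (fps_of_poly P) B n = (P * \poly_(i < N) B i)`_n.
Proof.
move=> lt_nN; rewrite coefM; apply: eq_bigr => i _.
by rewrite coef_poly (leq_ltn_trans (leq_subr _ _)).
Qed.

Lemma eq_coefMl (R : nzSemiRingType) (P P' Q : {poly R}) (n : nat) :
  (forall i, (i <= n)%N -> P`_i = P'`_i) -> (P * Q)`_n = (P' * Q)`_n.
Proof.
by move=> eqP; rewrite !coefM; apply: eq_bigr => i _; rewrite eqP // -ltnS.
Qed.

(** Quotients are identified by cross-multiplication: modulo ['X^n.+1], [P] may be replaced by
    [D * T], and then [D * I] by 1. *)
Lemma fps_divE (P D : {poly algC}) (B : fps) :
  D`_0 != 0 -> (forall n, fps_mul (fps_of_poly D) B n = P`_n) ->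
  forall n, fps_mul (fps_of_poly P) (fps_inv (fps_of_poly D)) n = B n.
Proof.
move=> D0 DB n; rewrite (fps_mul_poly _ _ (ltnSn n)).
set I := \poly_(i < _) _; pose T := \poly_(i < n.+1) B i.
rewrite (@eq_coefMl _ _ (D * T)) => [|i le_in]; last first.
  by rewrite -DB (@fps_mul_poly _ _ n.+1).
rewrite mulrAC (@eq_coefMl _ _ 1) => [|i le_in].
  by rewrite mul1r coef_poly ltnSn.
by rewrite coef1 -(fps_mul_poly _ _ _) // fps_mulV.
Qed.

Lemma fps_geometric (q : algC) (n : nat) :
  fps_mul (fps_of_poly 'X) (fps_inv (fps_of_poly (1 - q *: 'X))) n
    = if n == 0%N then 0 else q ^+ n.-1.
Proof.
apply: (fps_divE (B := fun n => if n == 0%N then 0 else q ^+ n.-1)) => [|{}n].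
  by rewrite coefB coefZ coef1 coefX mulr0 subr0 oner_eq0.
rewrite (fps_mul_poly _ _ (ltnSn n)) mulrBl mul1r -scalerAl.
rewrite coefB coefZ coefXM !coef_poly coefX ltnSn.
case: n => [|[|n]] /=; rewrite ?mulr0 ?subr0 //.
by rewrite ltnW ?ltnSn // exprS subrr.
Qed.

(** Division by a monic [g] already works over the integers; over [algC] the remainder is a multiple
    of [g] of smaller size, hence zero. *)
Lemma monic_dvd_int (g h : {poly int}) :
  g \is monic -> (map_poly intr g : {poly algC}) %| map_poly intr h ->
  exists r, h = r * g.
Proof.
move=> g_monic dvd_gh; have hE := Pdiv.RingMonic.rdivp_eq g_monic h.
exists (Pdiv.Ring.rdivp h g); rewrite {1}hE.
set d := Pdiv.Ring.rmodp h g in hE *.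
suff -> : d = 0 by rewrite addr0.
apply/eqP; apply: contraT => d0.
have : (map_poly intr g : {poly algC}) %| map_poly intr d.
  by move: dvd_gh; rewrite hE rmorphD rmorphM dvdp_addr // dvdp_mull.
have size_intr (P : {poly int}) : size (map_poly intr P : {poly algC}) = size P.
  exact: size_map_inj_poly (@intr_inj algC) (mulr0z 1) P.
move/dvdp_leq; rewrite -size_poly_eq0 !size_intr size_poly_eq0 => /(_ d0).
by rewrite leqNgt Pdiv.Ring.ltn_rmodpN0 // monic_neq0.
Qed.

Lemma monic_content (g : {poly int}) :
  g \is monic -> \big[gcdn/0%N]_(c <- g) absz c = 1%N.
Proof.
move=> /monicP g1; have g_neq0 : (0 < size g)%N.
  by rewrite size_poly_gt0 -lead_coef_eq0 g1.
have in_g : 1 \in (g : seq int) by rewrite -g1 mem_nth // prednK.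
by rewrite (big_rem _ in_g) /= gcd1n.
Qed.

(** * The trace and the additive character [psi] *)

Section AdditiveCharacter.
Variables (p k : nat) (F : finFieldType).
Hypotheses (p_pr : prime p) (k_gt0 : (0 < k)%N) (cardF : #|F| = (p ^ k)%N).

Let pcharF : p \in [pchar F] := card_finPcharP cardF p_pr.

Lemma TrD (b c : F) : Tr p k (b + c) = Tr p k b + Tr p k c.
Proof.
rewrite /Tr -big_split; apply: eq_bigr => i _ /=.
by apply: exprDn_pchar; rewrite (eq_pnat _ (pcharf_eq pcharF)) pnatX pnat_id.
Qed.

(** Frobenius shifts the summands cyclically, since [b ^+ (p ^ k) = b]. *)
Lemma Tr_Frobenius (b : F) : Tr p k b ^+ p = Tr p k b.
Proof.
rewrite -(pFrobenius_autE pcharF) /Tr rmorph_sum /=.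
case: k k_gt0 cardF => // k' _ cardF'.
rewrite big_ord_recr big_ord_recl /= expn0 expr1 addrC; congr (_ + _).
  by rewrite pFrobenius_autE -exprM -expnSr -cardF' expf_card.
by apply: eq_bigr => i _; rewrite pFrobenius_autE -exprM -expnSr.
Qed.

(** The trace polynomial [T] is nonzero, its coefficient of ['X] being 1, and has degree at most
    [p ^ k.-1], too small to vanish at all [p ^ k] elements. *)
Lemma Tr_neq0 : exists b : F, Tr p k b != 0.
Proof.
apply/existsP; apply: contraT => /existsPn Tr0.
pose T : {poly F} := \sum_(i < k) 'X^(p ^ i).
have T_neq0 : T != 0.
  apply/eqP=> /(congr1 (fun P : {poly F} => P`_1)).
  rewrite /T coef0 coef_sum; case: k k_gt0 => // k' _.
  rewrite big_ord_recl big1 => [|i _]; rewrite coefXn ?expn0 ?addr0.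
    by apply/eqP; rewrite oner_eq0.
  by rewrite ltn_eqF // -[X in (X < _)%N](expn0 p) ltn_exp2l ?prime_gt1.
have : (size (enum F) < size T)%N.
  apply: max_poly_roots; rewrite ?enum_uniq //.
  apply/allP=> b _; rewrite /root horner_sum.
  by under eq_bigr do rewrite hornerXn; apply: negbNE; apply: Tr0.
have : (size T <= (p ^ k.-1).+1)%N.
  apply: (leq_trans (size_sum _ _ _)); apply/bigmax_leqP => i _.
  rewrite size_polyXn ltnS leq_exp2l ?prime_gt1 //.
  by rewrite -ltnS prednK.
rewrite -cardE cardF => /(leq_trans _) le /le; rewrite ltnS.
by rewrite leq_exp2l ?prime_gt1 // -{1}(prednK k_gt0) ltnn.
Qed.

Local Notation psi := (@psi p k F).

Lemma psi_neq0 (b : F) : psi b != 0.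
Proof.
by rewrite expf_neq0 // (prim_root_eq0 (zeta_prim p_pr)) -lt0n prime_gt0.
Qed.

(** The integer representatives add only modulo [p], which suffices because [zeta p] has order
    [p]. *)
Lemma psiD (b c : F) : psi (b + c) = psi b * psi c.
Proof.
apply/eqP; rewrite -exprD (eq_prim_root_expr (zeta_prim p_pr)).
by rewrite -(natr_eq_mod _ _ pcharF) natrD !Fp_to_natK ?Tr_Frobenius ?TrD.
Qed.

Lemma psi0 : psi 0 = 1.
Proof. by apply: (mulfI (psi_neq0 0)); rewrite -psiD addr0 mulr1. Qed.

Lemma psi_sum (I : finType) (h : I -> F) :
  psi (\sum_i h i) = \prod_i psi (h i).
Proof. exact: (big_morph _ psiD psi0). Qed.

Lemma psi_eq1 (b : F) : (psi b == 1) = (Tr p k b == 0).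
Proof.
rewrite -(prim_order_dvd (zeta_prim p_pr)) (dvdn_pcharf pcharF).
by rewrite Fp_to_natK ?Tr_Frobenius.
Qed.

(** For [b != 0] the sum runs over all values of [psi]; translating by some [c] with [psi c != 1]
    multiplies it by [psi c], so it vanishes. *)
Lemma psi_orthogonality (b : F) :
  \sum_(m : F) psi (m * b) = (p ^ k)%:R * (b == 0)%:R.
Proof.
have [->|b_neq0] := eqVneq b 0.
  under eq_bigr do rewrite mulr0 psi0.
  by rewrite sumr_const -cardF mulr1.
rewrite mulr0 -(reindex_inj (mulIf b_neq0) (P := xpredT) (F := psi)).
have [c] := Tr_neq0; rewrite -psi_eq1 => psic_neq1.
have: \sum_m psi m = psi c * \sum_m psi m.
  rewrite mulr_sumr (reindex_inj (addrI c)) /=.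
  by under eq_bigr do rewrite psiD.
move/eqP; rewrite -{1}[\sum_m _]mul1r -subr_eq0 -mulrBl mulf_eq0 subr_eq0.
by rewrite eq_sym (negPf psic_neq1) /= => /eqP.
Qed.

(** * Counting solutions by character sums *)

Lemma Ns_char_sum (f : {poly F}) (a : F) (s : nat) :
  (p ^ k)%:R * (Ns f a s)%:R = \sum_(m : F) psi (- m * a) * S p k f m ^+ s.
Proof.
rewrite /Ns -sum1_card natr_sum mulr_sumr.
transitivity (\sum_(x : {ffun 'I_s -> F}) \sum_(m : F)
    psi (m * (\sum_(i < s) f.[x i] - a))).
  rewrite big_mkcond; apply: eq_bigr => x _.
  by rewrite psi_orthogonality inE subr_eq0; case: eqP; rewrite ?mulr0.
rewrite exchange_big; apply: eq_bigr => m _ /=.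
(* The [s]-th power of [S] expands into a sum over all tuples [x]. *)
rewrite -[s in RHS]card_ord -prodr_const bigA_distr_bigA mulr_sumr.
apply: eq_bigr => x _.
by rewrite mulrDr addrC psiD mulrN mulNr mulr_sumr psi_sum.
Qed.

Lemma us_char_sum (f : {poly F}) (a : F) (s : nat) :
  (p ^ k)%:R * (us p k f a s.+1)%:~R
    = \sum_(m | (m != 0) && (S p k f m != 0))
        psi (- m * a) * S p k f m ^+ s.+1 :> algC.
Proof.
have -> : (us p k f a s.+1)%:~R = (Ns f a s.+1)%:R - (p ^ k)%:R ^+ s :> algC.
  by rewrite /us rmorphB /= -natrX.
have S0 : S p k f 0 = (p ^ k)%:R.
  rewrite /S; under eq_bigr do rewrite mul0r psi0.
  by rewrite sumr_const -cardF.
(* The term [m = 0] cancels against the subtracted power of [q]; terms with [S = 0] drop out because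
   the exponent [s.+1] is positive. *)
rewrite mulrBr Ns_char_sum (bigD1 0) //= -exprS oppr0 mul0r psi0 S0 mul1r.
rewrite [X in X - _]addrC addrK [RHS]big_mkcondr; apply: eq_bigr => m _.
by case: eqP => //= ->; rewrite exprS mul0r mulr0.
Qed.

(** * Galois action on the sums and integrality of [mf] *)

Lemma psiMn (b : F) (t : nat) : psi (b *+ t) = psi b ^+ t.
Proof. by elim: t => [|t IH]; rewrite ?psi0 // mulrS psiD IH exprS. Qed.

Lemma S_aut (u : {rmorphism algC -> algC}) :
  exists2 c : F, c != 0 & forall f m, u (S p k f m) = S p k f (c * m).
Proof.
have [t cop ut] := aut_prim_rootP u (zeta_prim p_pr).
exists t%:R => [|f m].
  by rewrite -(dvdn_pcharf pcharF) -prime_coprime // coprime_sym.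
rewrite /S rmorph_sum; apply: eq_bigr => x _ /=.
by rewrite -mulrA mulr_natl psiMn rmorphXn /= ut exprAC.
Qed.

Lemma OmegaP (f : {poly F}) (l : algC) :
  reflect (exists m : F, [/\ m != 0, S p k f m != 0 & l = S p k f m])
          (l \in Omega p k f).
Proof.
rewrite mem_undup; apply: (iffP mapP) => [[m]|[m [m0 Sm0 ->]]].
  by rewrite mem_filter => /andP[/andP[? ?] _] ->; exists m.
by exists m; rewrite // mem_filter m0 Sm0 mem_enum.
Qed.

(** By [S_aut], [u] maps [Omega] into itself; being injective on a finite set, it permutes the
    roots. *)
Lemma mf_aut (u : {rmorphism algC -> algC}) (f : {poly F}) :
  map_poly u (mf p k f) = mf p k f.
Proof.
have [c c0 uS] := S_aut u; rewrite /mf rmorph_prod /=.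
under eq_bigr do rewrite map_polyXsubC.
rewrite -(big_map u xpredT (fun l => 'X - l%:P)); apply: perm_big.
have uniq_u : uniq (map u (Omega p k f)).
  by rewrite (map_inj_uniq (fmorph_inj u)) undup_uniq.
have sub_u : {subset map u (Omega p k f) <= Omega p k f}.
  move=> _ /mapP[_ /OmegaP[m [m0 Sm0 ->]] ->]; apply/OmegaP.
  by exists (c * m); rewrite mulf_neq0 // -uS fmorph_eq0.
have [|_ eq_u] := uniq_min_size uniq_u sub_u; first by rewrite size_map.
by apply: uniq_perm => //; apply: undup_uniq.
Qed.

Lemma mf_int (f : {poly F}) : mf p k f \is a polyOver Num.int.
Proof.
(* Lifting along [ev] records that the coefficients of [mf] lie in [Z[zeta]], the form that
   [Galois_invariant_int] requires. *)
pose ev : {rmorphism {poly int} -> algC} :=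
  horner_eval (zeta p) \o map_poly intr.
have evS m : exists P, S p k f m = ev P.
  exists (\sum_(x : F) 'X^(Fp_to_nat p (Tr p k (m * f.[x])))).
  rewrite rmorph_sum; apply: eq_bigr => x _ /=.
  by rewrite map_polyXn /horner_eval hornerXn.
have [Q mfE] : exists Q : {poly {poly int}}, mf p k f = map_poly ev Q.
  rewrite /mf; have : all [in Omega p k f] (Omega p k f) by apply/allP.
  elim: {2 3}(Omega p k f) => [|l s IHs] /=.
    by exists 1; rewrite big_nil rmorph1.
  case/andP=> /OmegaP[m [_ _ ->]] /IHs[Q QE]; have [P PE] := evS m.
  exists (('X - P%:P) * Q).
  by rewrite big_cons QE rmorphM /= map_polyXsubC PE.
apply/polyOverP => i; have /polyP/(_ i) := mfE; rewrite coef_map => coefE.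
rewrite coefE; apply: (Galois_invariant_int p_pr (zeta_prim p_pr)) => u.
by rewrite -[_.[_]]coefE -coef_map mf_aut.
Qed.

(** * Recurrences and the minimal polynomial *)

Local Notation q := ((p ^ k)%N%:R : algC).

Let q_neq0 : q != 0.
Proof. by rewrite pnatr_eq0 -lt0n expn_gt0 prime_gt0. Qed.

(** A recurrence acts on each geometric sequence [S ^+ s] through the value of [g] at [S], so both
    directions reduce to roots of [g]. *)
Lemma recurrence_char_sum (f : {poly F}) (a : F) (g : {poly int}) (j : nat) :
  q * (\sum_(i < size g) g`_i * us p k f a (j + i).+1)%:~R
    = \sum_(m | (m != 0) && (S p k f m != 0))
        psi (- m * a) * (S p k f m ^+ j.+1 * (map_poly intr g).[S p k f m]).
Proof.
rewrite rmorph_sum mulr_sumr.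
under eq_bigr do rewrite rmorphM mulrCA us_char_sum mulr_sumr.
rewrite exchange_big; apply: eq_bigr => m _ /=.
rewrite (horner_coef_wide _ (size_poly _ _)) !mulr_sumr; apply: eq_bigr => i _.
by rewrite coef_map -addSn exprD mulrCA; congr (_ * _); rewrite mulrCA.
Qed.

Lemma root_mf (f : {poly F}) (m : F) :
  m != 0 -> S p k f m != 0 -> root (mf p k f) (S p k f m).
Proof.
by move=> m0 Sm0; rewrite /mf root_prod_XsubC; apply/OmegaP; exists m.
Qed.

Lemma gen_poly_of_mf (f : {poly F}) (a : F) (g : {poly int}) :
  map_poly intr g = mf p k f -> is_gen_poly (us p k f a) g.
Proof.
move=> gE; split.
  have : mf p k f != 0 by rewrite monic_neq0 // monic_prod_XsubC.
  by apply: contraNneq => g0; rewrite -gE g0 rmorph0.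
move=> j; apply/eqP; rewrite -(intr_eq0 algC) -(mulrI_eq0 _ (mulfI q_neq0)).
rewrite recurrence_char_sum big1 // => m /andP[m0 Sm0].
by rewrite gE (rootP (root_mf m0 Sm0)) !mulr0.
Qed.

Lemma mf_dvd_gen_poly (f : {poly F}) (h : {poly int}) :
  is_gen_poly (us p k f 0) h -> mf p k f %| map_poly intr h.
Proof.
case=> _ rec_h; set H := map_poly intr h.
have power_sums j : \sum_(m | (m != 0) && (S p k f m != 0))
    S p k f m ^+ j.+1 * H.[S p k f m] = 0.
  have := recurrence_char_sum f 0 h j; rewrite rec_h mulr0z mulr0 => rec0.
  rewrite [RHS]rec0.
  by apply: eq_bigr => m _; rewrite mulr0 psi0 mul1r.
(* Combining the relations for all [j] with the coefficients of [P] gives an arbitrary test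
   polynomial. *)
have moments (P : {poly algC}) : \sum_(m | (m != 0) && (S p k f m != 0))
    S p k f m * H.[S p k f m] * P.[S p k f m] = 0.
  under eq_bigr do rewrite [P.[_]]horner_coef mulr_sumr.
  rewrite exchange_big big1 // => i _ /=.
  have := congr1 ( *%R P`_i) (power_sums i); rewrite mulr0 mulr_sumr => sum0.
  rewrite -[RHS]sum0; apply: eq_bigr => m _.
  by rewrite exprS mulrCA mulrAC.
apply: uniq_roots_dvdp; last by rewrite uniq_rootsE undup_uniq.
apply/allP=> l l_Omega; case/OmegaP: (l_Omega) => m0 [m0_neq0 Sm0 lE].
(* This test polynomial keeps only the indices [m] with [S p k f m = l]. *)
pose P := \prod_(l' <- rem l (Omega p k f)) ('X - l'%:P).
have P_root x : root P x = (x != l) && (x \in Omega p k f).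
  by rewrite root_prod_XsubC mem_rem_uniq ?undup_uniq.
have Pl : P.[l] != 0 by have := P_root l; rewrite eqxx /= /root => ->.
pose A := [pred m | [&& m != 0, S p k f m != 0 & S p k f m == l]].
have : \sum_(m | A m) l * H.[l] * P.[l] = 0.
  rewrite -[RHS](moments P) [RHS](bigID (fun m => S p k f m == l)) /=.
  rewrite [X in _ + X]big1 => [|m /andP[/andP[m1 Sm] Sl]].
    rewrite addr0; apply: eq_big => [m|m]; first by rewrite /A /= andbA.
    by case/and3P=> _ _ /eqP ->.
  suff /rootP -> : root P (S p k f m) by rewrite mulr0.
  by rewrite P_root Sl; apply/OmegaP; exists m.
(* All surviving terms are equal, so their sum is [#|A|] times one term; [#|A|] is positive and [l],
   [P.[l]] are nonzero, which leaves [H.[l] = 0]. *)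
move/eqP; rewrite sumr_const mulrn_eq0 -leqn0 leqNgt.
have -> : (0 < #|A|)%N.
  by apply/card_gt0P; exists m0; rewrite inE m0_neq0 Sm0 lE eqxx.
have l0 : l != 0 by rewrite lE.
by rewrite /= !mulf_eq0 (negPf l0) (negPf Pl) orbF.
Qed.

Lemma min_poly_of_mf (f : {poly F}) (g : {poly int}) :
  map_poly intr g = mf p k f -> is_min_poly (us p k f 0) g.
Proof.
move=> gE; have g_monic : g \is monic.
  have : mf p k f \is monic by apply: monic_prod_XsubC.
  rewrite -gE !monicE lead_coef_map_inj ?rmorph0 //; last exact: intr_inj.
  by rewrite -(eqr_int algC).
have dvd_g h : is_gen_poly (us p k f 0) h -> exists r, h = r * g.
  by move=> /mf_dvd_gen_poly; rewrite -gE; apply: monic_dvd_int.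
split=> //; [exact: gen_poly_of_mf | | exact: monic_content].
move=> h gen_h; have [r hE] := dvd_g h gen_h.
have [+ _] := gen_h; rewrite hE mulf_eq0 => /norP[r0 g0].
by rewrite size_mul // -(prednK (_ : 0 < size r)%N) ?size_poly_gt0 // leq_addl.
Qed.

(** * The generating function *)

Lemma fps_char_sum (f : {poly F}) (a : F) (n : nat) :
  fps_mul (fps_of_poly ('X * Mt p k f a))
          (fps_inv (fps_of_poly (q *: Mf p k f))) n
    = if n == 0%N then 0 else
      - (q^-1 * \sum_(m | (m != 0) && (S p k f m != 0))
                  psi (- m * a) * S p k f m ^+ n).
Proof.
(* In partial fractions, [Mt / Mf] is the sum of [psi (- m * a) / ('X - S^-1)], and
   ['X / ('X - S^-1)] expands as minus the sum of [S ^+ n * 'X^n] over [n >= 1]. *)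
apply: (fps_divE (B := fun n => if n == 0%N then 0 else
   - (q^-1 * \sum_(m | (m != 0) && (S p k f m != 0))
               psi (- m * a) * S p k f m ^+ n))) => [|{}n].
  rewrite coefZ mulf_neq0 // -horner_coef0 /Mf horner_prod prodf_seq_neq0.
  apply/allP=> m _; apply/implyP=> /andP[_ Sm0].
  by rewrite !hornerE oppr_eq0 invr_eq0.
rewrite (fps_mul_poly _ _ (ltnSn n)).
(* [('X - x^-1) * geo x = - 'X] modulo ['X^n.+1] *)
pose geo (x : algC) := \poly_(i < n.+1) (if i == 0%N then 0 else x ^+ i).
set T := \poly_(i < _) _.
have -> : T = - q^-1 *: \sum_(m | (m != 0) && (S p k f m != 0))
                 psi (- m * a) *: geo (S p k f m).
  apply/polyP=> i; rewrite coefZ coef_sum coef_poly.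
  case: ltnP => [lt_in|le_ni]; last first.
    rewrite big1 ?mulr0 // => m _.
    by rewrite coefZ coef_poly ltnNge le_ni mulr0.
  case: eqP => [i0|/eqP i0].
    by rewrite big1 ?mulr0 // => m _; rewrite coefZ coef_poly lt_in i0 mulr0.
  rewrite mulNr; congr (- (_ * _)); apply: eq_bigr => m _.
  by rewrite coefZ coef_poly lt_in (negPf i0).
rewrite -scalerAl -scalerAr scalerA mulrN divff // scaleN1r coefN.
rewrite mulr_sumr coef_sum /Mt mulr_sumr coef_sum -sumrN.
apply: eq_bigr => m Am; rewrite -!scalerAr !coefZ -mulrN; congr (_ * _).
have Sm0 : S p k f m != 0 by case/andP: Am.
rewrite /Mf (bigD1 m) //= mulrAC -coefN -mulNr.
rewrite (@eq_coefMl _ _ 'X) => [|i le_in].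
  congr (('X * _)`_n); apply: eq_bigl => m'.
  by rewrite -andbA [X in _ && X]andbC.
rewrite coefN mulrBl coefB coefXM coefCM !coef_poly coefX.
case: i le_in => [|[|i]] le_in /=; rewrite ?mulr0 ?subr0 ?oppr0 //.
  by rewrite ltnS le_in expr1 mulVf // sub0r opprK.
have lt_in : (i.+2 < n.+1)%N by [].
by rewrite lt_in (ltnW lt_in) [_ ^+ i.+2]exprS mulKf // subrr oppr0.
Qed.

Lemma Mt0_deriv (f : {poly F}) : Mt p k f 0 = (Mf p k f)^`().
Proof.
rewrite /Mf deriv_prod ?index_enum_uniq //; apply: eq_bigr => n _.
rewrite mulr0 psi0 scale1r derivXsubC mul1r; apply: eq_bigl => m.
by rewrite -andbA [X in _ && X]andbC.
Qed.

Lemma Ns_char_sum_nonzero (f : {poly F}) (a : F) (n : nat) :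
  (Ns f a n.+1)%:R = q ^+ n + q^-1 * \sum_(m | (m != 0) && (S p k f m != 0))
                      psi (- m * a) * S p k f m ^+ n.+1 :> algC.
Proof.
by rewrite -us_char_sum mulKf // /us rmorphB /= -natrX addrC subrK.
Qed.

End AdditiveCharacter.

Theorem theorem1p1 (p k : nat) (F : finFieldType) (f : {poly F}) (a : F) :
  prime p -> (0 < k)%N -> #|F| = (p ^ k)%N ->
  (* (i) *)
  (exists g : {poly int},
      [/\ map_poly (fun z : int => z%:~R : algC) g = mf p k f,
          is_gen_poly (us p k f a) g &
          is_min_poly (us p k f 0) g])
  /\
  (* (ii) *)
  (forall n : nat,
     (if n == 0%N then 0 else (Ns f a n)%:R) =
     fps_sub
       (fps_mul (fps_of_poly 'X)
                (fps_inv (fps_of_poly (1 - (p ^ k)%:R *: 'X))))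
       (fps_mul (fps_of_poly ('X * Mt p k f a))
                (fps_inv (fps_of_poly ((p ^ k)%:R *: Mf p k f)))) n)
  /\
  Mt p k f 0 = (Mf p k f)^`().
Proof.
move=> p_pr k_gt0 cardF; split; last split.
(* [floorpP] lifts [mf] to an integer polynomial, and this single [g] serves all three claims. *)
- have [g gE] := floorpP (mf_int p_pr k_gt0 cardF f); exists g; split=> //.
    exact: gen_poly_of_mf.
  exact: min_poly_of_mf.
- move=> n; rewrite /fps_sub fps_geometric fps_char_sum //.
  case: n => [|n] /=; first by rewrite subr0.
  by rewrite opprK (Ns_char_sum_nonzero p_pr k_gt0 cardF).
- exact: Mt0_deriv.
Qed.
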